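(* Let $\kappa$ be a regular uncountable cardinal and $\lambda>\kappa$ a cardinal. Suppose that $\theta$ is an infinite cardinal $<\kappa$ such that $\kappa\to(\kappa,\theta)^2$, and $H$ is an ideal on $P_\kappa(\lambda)$ with $\mathrm{cof}(H)<\mathbf{non}_\kappa(\text{weakly selective})$. Then $H^+\xrightarrow[\kappa]{\kappa}(H^+,\theta+1)^2$.
   Context: For a cardinal $\mu$ and a set $A$, $P_\mu(A)=\{a\subseteq A:|a|<\mu\}$. An ideal on an infinite set $S$ is a collection $K$ of subsets of $S$ containing all singletons, closed under subsets and finite unions, with $S\notin K$; $K^+=P(S)\setminus K$; $K|A=\{B\subseteq S:B\cap A\in K\}$ for $A\in K^+$; $\mathrm{cof}(K)$ is the least cardinality of an $X\subseteq K$ with $K=\bigcup_{A\in X}P(A)$. $K$ is $\kappa$-complete if it is closed under unions of fewer than $\kappa$ members. ''Ideal on $\kappa$'' always means $\kappa$-complete ideal on $\kappa$. $I_{\kappa,\lambda}$ is the set of all $A\subseteq P_\kappa(\lambda)$ such that $A\cap\{b\in P_\kappa(\lambda):a\subseteq b\}=\emptyset$ for some $a\in P_\kappa(\lambda)$. ''Ideal on $P_\kappa(\lambda)$'' always means a $\kappa$-complete ideal $H$ on $P_\kappa(\lambda)$ that is fine ($I_{\kappa,\lambda}\subseteq H$). For $A\subseteq\kappa$, $[A]^2=\{(\xi,\eta)\in A\times A:\xi<\eta\}$. $\kappa\to(\kappa,\alpha)^2$ means: for every $f:[\kappa]^2\to 2$ there is $A\subseteq\kappa$ such that either $A$ has order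 type $\kappa$ and $f$ is identically $0$ on $[A]^2$, or $A$ has order type $\alpha$ and $f$ is identically $1$ on $[A]^2$. An ideal $J$ on $\kappa$ is a weak $P$-point if for every $A\in J^+$ and $f\in{}^A\kappa$ with $\{f^{-1}(\{\alpha\}):\alpha<\kappa\}\subseteq J$ there is $B\in J^+\cap P(A)$ such that $f$ is $<\kappa$-to-one on $B$. $J$ is a local $Q$-point if for every $g\in{}^\kappa\kappa$ there is $B\in J^+$ such that $g(\alpha)<\beta$ for all $(\alpha,\beta)\in[B]^2$; $J$ is a weak $Q$-point if $J|A$ is a local $Q$-point for every $A\in J^+$. $J$ is weakly selective if it is both a weak $P$-point and a weak $Q$-point. $\mathbf{non}_\kappa(\text{weakly selective})$ is the least cardinal $\tau$ such that there is an ideal $J$ on $\kappa$ with $\mathrm{cof}(J)=\tau$ that is not weakly selective. For $A\subseteq P_\kappa(\lambda)$, $[A]^2_{\kappa,\kappa}=\{(\bigcup(a\cap\kappa),\bigcup(b\cap\kappa)):a,b\in A,\ \bigcup(a\cap\kappa)<\bigcup(b\cap\kappa)\}$. For $a,b\in P_\kappa(\lambda)$, $a\prec b$ means $a\subseteq b$ and $\bigcup(a\cap\kappa)<\bigcup(b\cap\kappa)$. For an ordinal $\alpha$, $H^+\xrightarrow[\kappa]{\kappa}(H^+,\alpha)^2$ means: for every $F:[P_\kappa(\lambda)]^2_{\kappa,\kappa}\to2$ and every $A\in H^+$ there is $B\subseteq A$ such that either $B\in H^+$ and $F$ is identically $0$ on $[B]^2_{\kappa,\kappa}$, or $(B,\prec)$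 has order type $\alpha$ and $F$ is identically $1$ on $[B]^2_{\kappa,\kappa}$. *)

(* Defs.v *)
(* Ordinals.  The cardinal lambda is a well-ordered type L all of whose proper
   initial segments have smaller cardinality than L.  An ordinal x < lambda is
   an element x : L, identified with the set [below x] of its predecessors;
   in particular kappa < lambda is an element of L, and subsets of kappa are
   subsets of L included in [below kappa].  Where an ordinal serves as an order
   type it is given directly as an initial segment of L, so that the
   von Neumann successor x + 1 is the segment [upto x].

   Cardinals.  A cardinal is given by any set that has that cardinality. *)
From mathcomp Require Import all_boot all_order.
From mathcomp Require Import boolp classical_sets functions cardinality.
From mathcomp Require wochoice.

Set Implicit Arguments.
Unset Strict Implicit.
Unset Printing Implicit Defensive.

Local Open Scope order_scope.
Local Open Scope classical_set_scope.
Local Open Scope card_scope.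

Definition card_lt (T U : Type) (A : set T) (B : set U) : Prop :=
  A #<= B /\ A #!= B.
Notation "A '#<' B" := (card_lt A B) (at level 79) : card_scope.

Definition below (d : Order.disp_t) (L : orderType d) (x : L) : set L :=
  [set y | y < x].

Definition upto (d : Order.disp_t) (L : orderType d) (x : L) : set L :=
  [set y | y <= x].

Definition initial_ordinal (d : Order.disp_t) (L : orderType d) : Prop :=
  wochoice.well_order (<=%O : rel L) /\ forall x : L, below x #< [set: L].

Definition is_cardinal (d : Order.disp_t) (L : orderType d) (x : L) : Prop :=
  forall y : L, y < x -> below y #< below x.

(* x is equal to its own cofinality *)
Definition regular (d : Order.disp_t) (L : orderType d) (x : L) : Prop :=
  [/\ is_cardinal x, infinite_set (below x) &
    forall A : set L, A `<=` below x ->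
      (forall y, y < x -> exists2 z, A z & y <= z) ->
      A #= below x].

Definition uncountable_regular (d : Order.disp_t) (L : orderType d) (x : L) :
    Prop :=
  regular x /\ ~ countable (below x).

Definition infinite_cardinal (d : Order.disp_t) (L : orderType d) (x : L) :
    Prop :=
  is_cardinal x /\ infinite_set (below x).

(* (B, R) is isomorphic to the initial segment alpha of L with its strict
   order *)
Definition has_order_type (d : Order.disp_t) (L : orderType d) (T : Type)
    (R : T -> T -> Prop) (B : set T) (alpha : set L) : Prop :=
  exists2 g : L -> T, set_bij alpha B g &
    forall x y, alpha x -> alpha y -> (x < y <-> R (g x) (g y)).

Definition ideal (T : Type) (S : set T) (J : set (set T)) : Prop :=
  [/\ infinite_set S,
      forall A, J A -> A `<=` S,
      forall s, S s -> J [set s],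
      forall A B, B `<=` A -> J A -> J B &
      (forall A B, J A -> J B -> J (A `|` B)) /\ ~ J S].

Definition positive (T : Type) (S : set T) (J : set (set T)) : set (set T) :=
  [set A | A `<=` S /\ ~ J A].

Definition restrict_ideal (T : Type) (S : set T) (J : set (set T))
    (A : set T) : set (set T) :=
  [set B | B `<=` S /\ J (B `&` A)].

Definition complete (d : Order.disp_t) (L : orderType d) (k : L) (T : Type)
    (J : set (set T)) : Prop :=
  forall X : set (set T), X `<=` J -> X #< below k ->
    J (\bigcup_(A in X) A).

Definition generates (T : Type) (X J : set (set T)) : Prop :=
  X `<=` J /\ J = \bigcup_(A in X) [set B | B `<=` A].

(* the set c has cardinality cof(J) *)
Definition is_cof (T : Type) (J : set (set T)) (U : Type) (c : set U) : Prop :=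
  (exists2 X, generates X J & X #= c) /\
  (forall X, generates X J -> c #<= X).

Definition pairs (d : Order.disp_t) (L : orderType d) (A : set L) :
    set (L * L) :=
  [set p | [/\ A p.1, A p.2 & p.1 < p.2]].

Definition ideal_on (d : Order.disp_t) (L : orderType d) (k : L)
    (J : set (set L)) : Prop :=
  ideal (below k) J /\ complete k J.

(* A function on A `<=` kappa with values in kappa is given by a function on L,
   whose values outside A are irrelevant. *)
Definition weak_P_point (d : Order.disp_t) (L : orderType d) (k : L)
    (J : set (set L)) : Prop :=
  forall (A : set L) (f : L -> L), positive (below k) J A ->
    set_fun A (below k) f ->
    (forall a, below k a -> J (A `&` f @^-1` [set a])) ->
    exists B, [/\ positive (below k) J B, B `<=` A &
      forall a, below k a -> (B `&` f @^-1` [set a]) #< below k].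

Definition local_Q_point (d : Order.disp_t) (L : orderType d) (k : L)
    (J : set (set L)) : Prop :=
  forall g : L -> L, set_fun (below k) (below k) g ->
    exists2 B, positive (below k) J B &
      forall p, pairs B p -> g p.1 < p.2.

Definition weak_Q_point (d : Order.disp_t) (L : orderType d) (k : L)
    (J : set (set L)) : Prop :=
  forall A, positive (below k) J A ->
    local_Q_point k (restrict_ideal (below k) J A).

Definition weakly_selective (d : Order.disp_t) (L : orderType d) (k : L)
    (J : set (set L)) : Prop :=
  weak_P_point k J /\ weak_Q_point k J.

(* the set c has cardinality non_kappa(weakly selective) *)
Definition is_non_weakly_selective (d : Order.disp_t) (L : orderType d) (k : L)
    (U : Type) (c : set U) : Prop :=
  (exists J, [/\ ideal_on k J, ~ weakly_selective k J & is_cof J c]) /\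
  (forall (J : set (set L)) (X : set (set L)),
    ideal_on k J -> ~ weakly_selective k J -> is_cof J X -> c #<= X).

(* kappa --> (kappa, alpha)^2; the colours 0 and 1 are [false] and [true] *)
Definition arrow (d : Order.disp_t) (L : orderType d) (k : L)
    (alpha : set L) : Prop :=
  forall f : L * L -> bool,
    exists2 A : set L, A `<=` below k &
      (has_order_type (fun x y : L => x < y) A (below k) /\
         forall p, pairs A p -> f p = false) \/
      (has_order_type (fun x y : L => x < y) A alpha /\
         forall p, pairs A p -> f p = true).

Definition Pkl (d : Order.disp_t) (L : orderType d) (k : L) : set (set L) :=
  [set a | a #< below k].

(* The union of a set of ordinals is its least upper bound.  The library's
   [supremum] is not used because it returns its default value on the empty
   set, whereas here the empty union has to be 0, the least upper bound of the
   empty set.  The default k is never reached: in a well-order every set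
   bounded by k has a least upper bound. *)
Definition union_cap (d : Order.disp_t) (L : orderType d) (k : L)
    (a : set L) : L :=
  xget k (supremums (a `&` below k)).

Definition prec (d : Order.disp_t) (L : orderType d) (k : L)
    (a b : set L) : Prop :=
  a `<=` b /\ union_cap k a < union_cap k b.

(* [A]^2_{kappa,kappa} *)
Definition pairs_kk (d : Order.disp_t) (L : orderType d) (k : L)
    (A : set (set L)) : set (L * L) :=
  [set p | exists a b, [/\ A a, A b, union_cap k a < union_cap k b &
                           p = (union_cap k a, union_cap k b)]].

(* I_{kappa,lambda} *)
Definition bounded_ideal (d : Order.disp_t) (L : orderType d) (k : L) :
    set (set (set L)) :=
  [set A | A `<=` Pkl k /\
    exists2 a, Pkl k a & A `&` [set b | Pkl k b /\ a `<=` b] = set0].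

Definition ideal_on_Pkl (d : Order.disp_t) (L : orderType d) (k : L)
    (H : set (set (set L))) : Prop :=
  [/\ ideal (Pkl k) H, complete k H & bounded_ideal k `<=` H].

(* H^+ --> (H^+, alpha)^2 with both decorations equal to kappa.  A colouring of
   [P_kappa(lambda)]^2_{kappa,kappa} is given by one of L * L, whose other
   values are irrelevant. *)
Definition arrow_kk (d : Order.disp_t) (L : orderType d) (k : L)
    (H : set (set (set L))) (alpha : set L) : Prop :=
  forall (F : L * L -> bool) (A : set (set L)), positive (Pkl k) H A ->
    exists2 B : set (set L), B `<=` A &
      (positive (Pkl k) H B /\ forall p, pairs_kk k B p -> F p = false) \/
      (has_order_type (prec k) B alpha /\
         forall p, pairs_kk k B p -> F p = true).

(* Main.v *)
(* Write pi(a) for the supremum of a `&` kappa.  Suppose that A in H^+ has no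
   0-homogeneous subset in H^+.  The heart of the proof is that every positive
   B `<=` A is then covered, up to a set of H, by fewer than kappa of the sets
   N_x = {b in B | x < pi(b), F(x, pi(b)) = 1}, x in pi[B].  Otherwise H | B
   projects under pi to an ideal on kappa which stays proper and
   kappa-complete when all the sets {z | x < z, F(x, z) = 1} are added to it.
   The enlarged ideal has cofinality at most cof(H), so it is weakly selective;
   the weak P-point and weak Q-point properties then produce a positive
   0-homogeneous set.

   By fineness N_x may be replaced by {b in N_x | a `<=` b} for some a in B with
   pi(a) = x.  Iterating such coverings theta times gives a tree of
   1-homogeneous chains with fewer than kappa successors at each node.  The
   relation kappa --> (kappa, theta)^2, applied to the lexicographic order, shows
   that each level below theta has fewer than kappa nodes, so that only a set of
   H is lost altogether.  Any remaining element of A lies on top of a chain of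
   type theta. *)
Require Import Defs.
From mathcomp Require Import all_boot all_order.
From mathcomp Require Import boolp classical_sets functions cardinality.
From mathcomp Require wochoice.

Set Implicit Arguments.
Unset Strict Implicit.
Unset Printing Implicit Defensive.

Import Order.TTheory.

Local Open Scope order_scope.
Local Open Scope classical_set_scope.
Local Open Scope card_scope.

(** * Cardinals and well-orders *)

Lemma card_le_injP T U (A : set T) (B : set U) (f : T -> U) :
  (forall x, A x -> B (f x)) ->
  (forall x y, A x -> A y -> f x = f y -> x = y) -> A #<= B.
Proof.
move=> fAB finj.
have [g] : $|{injfun A >-> B}|.
  apply/injfunPex; exists f => [x /fAB//|x y].
  by rewrite !inE => ? ?; exact: finj.
exact: inj_card_le g.
Qed.

Lemma card_le_inj T U (u : U) (A : set T) (B : set U) : A #<= B ->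
  exists f : T -> U, (forall x, A x -> B (f x)) /\
    (forall x y, A x -> A y -> f x = f y -> x = y).
Proof.
move=> /card_leP[F].
exists (fun x => if pselect (x \in A) is left p then val (F (exist _ x p)) else u).
split=> [x Ax|x y Ax Ay].
  case: pselect => [p|]; last by rewrite inE.
  by have := valP (F (exist _ x p)); rewrite inE.
case: pselect => [p|]; last by rewrite inE.
case: pselect => [q|]; last by rewrite inE.
by move=> /val_inj /(@inj _ _ _ F) -/(_ (in_setT _) (in_setT _)) [].
Qed.

Lemma choice_function U (u : U) :
  exists c : set U -> U, forall P, P !=set0 -> P (c P).
Proof.
suff /choice[c cP] : forall P : set U, exists x, P !=set0 -> P x by exists c.
move=> P; by have [[x Px]|nP] := pselect (P !=set0); [exists x|exists u].
Qed.

(* A maximal family of everywhere distinct choice functions exhausts one of the sets. *)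
Lemma exists_card_min T (P : set (set T)) : P !=set0 ->
  exists2 A, P A & forall B, P B -> A #<= B.
Proof.
move=> [A0 PA0].
have [[t0 _]|nT] := pselect (exists t : T, True); last first.
  exists A0 => // B _; apply: subset_card_le => x _.
  by case: nT; exists x.
pose Q (Phi : set (set T -> T)) :=
  (forall f X, Phi f -> P X -> X (f X)) /\
  (forall f g X, Phi f -> Phi g -> P X -> f X = g X -> f = g).
have [F FQ Ftot|Phi [[Phi1 Phi2] max]] := @Zorn_bigcup _ Q.
  split=> [f X [Phi FPhi fPhi]|f g X [Phi FPhi Phif] [Psi FPsi Psig]].
    exact: (FQ _ FPhi).1.
  have [s|s] := Ftot _ _ FPhi FPsi.
    by apply: (FQ _ FPsi).2; [exact: s|].
  by apply: (FQ _ FPhi).2; [|exact: s].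
have [[X PX sX]|nX] := pselect (exists2 X, P X &
    forall x, X x -> exists2 f, Phi f & f X = x).
  exists X => // Y PY.
  have /choice[h hP] : forall x, exists f, X x -> Phi f /\ f X = x.
    move=> x; have [/sX[f ? ?]|nXx] := pselect (X x); first by exists f.
    by exists (fun=> t0).
  apply: (@card_le_injP _ _ _ _ (fun x => h x Y)) => [x /hP[]|x y].
    by move=> /Phi1 + _; exact.
  move=> /hP[hx xE] /hP[hy yE] hxy.
  by rewrite -xE -yE (Phi2 _ _ _ hx hy PY hxy).
have /choice[g gP] : forall X, exists x, P X -> X x /\ forall f, Phi f -> f X <> x.
  move=> X; have [PX|] := pselect (P X); last by exists t0.
  apply: contra_notP nX => /forallNP nX; exists X => // x Xx.
  apply: contra_notP (nX x) => nf _; split => // f Phif fx.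
  by apply: nf; exists f.
case: (max (Phi `|` [set g])).
  split=> [f Phif|]; first by left.
  move=> /(_ g (or_intror erefl)) Phig.
  exact: (gP _ PA0).2 Phig erefl.
split=> [f X [/Phi1|->]|f1 f2 X].
- exact.
- by move=> /gP[].
- move=> [Phif|->] [Phig|->] PX //.
  + exact: Phi2.
  + by move=> /(gP _ PX).2.
  + by move/esym => /(gP _ PX).2.
Qed.

(** [exists_card_min] for a family of two sets compares them; the tags [inl] and [inr] put both in
    one type. *)
Lemma card_le_total T U (A : set T) (B : set U) : A #<= B \/ B #<= A.
Proof.
have AE : (inl : T -> T + U) @` A #= A by apply: inj_card_eq => x y _ _ [].
have BE : (inr : U -> T + U) @` B #= B by apply: inj_card_eq => x y _ _ [].
have [_ [->|->] minX] := @exists_card_min _ [set (@inl T U) @` A; (@inr T U) @` B]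
  (ex_intro _ _ (or_introl erefl)).
- have := minX _ (or_intror erefl).
  by rewrite (card_le_eql AE) (card_le_eqr BE); left.
- have := minX _ (or_introl erefl).
  by rewrite (card_le_eql BE) (card_le_eqr AE); right.
Qed.

Lemma card_ltNge T U (A : set T) (B : set U) : A #< B <-> ~ (B #<= A).
Proof.
split=> [[AB nAB] BA|nBA].
  by move/negP: nAB; apply; rewrite card_eq_le AB BA.
have AB : A #<= B by have [] := card_le_total A B.
by split=> //; apply/negP; rewrite card_eq_le => /andP[].
Qed.

Lemma card_le_lt_trans T U V (A : set T) (B : set U) (C : set V) :
  A #<= B -> B #< C -> A #< C.
Proof.
move=> AB /card_ltNge nCB; apply/card_ltNge => CA.
exact/nCB/(card_le_trans CA).
Qed.

(** Hilbert's hotel: [f] sends [x] to [e 0], each [e n] to [e n.+1], and fixes the rest. *)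
Lemma infinite_setU1_le T (A : set T) x : infinite_set A -> A `|` [set x] #<= A.
Proof.
have [Ax|nAx] := pselect (A x).
  by move=> _; rewrite setUidl// => y ->.
move=> /infiniteP /(card_le_inj x)[e [eA einj]].
pose f y := if y == x :> {classic T} then e 0%N
  else if pselect (exists n, e n = y) is left p then e (projT1 (cid p)).+1 else y.
have fx : f x = e 0%N by rewrite /f eqxx.
have fe n : f (e n) = e n.+1.
  rewrite /f; case: eqP => [ex|_].
    by case: nAx; rewrite -ex; exact: eA.
  case: pselect => [p|[]]; last by exists n.
  by congr (e _.+1); apply: einj => //; case: cid.
have fE y : A y -> ~ (exists n, e n = y) -> f y = y.
  move=> Ay ny; rewrite /f; case: eqP => [yx|_]; first by case: nAx; rewrite -yx.
  by case: pselect.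
have cases y : (A `|` [set x]) y -> (y = x) \/ (exists n, e n = y) \/
    (A y /\ ~ exists n, e n = y).
  move=> [Ay|->]; last by left.
  by have [?|?] := pselect (exists n, e n = y); right; [left|right].
apply: (@card_le_injP _ _ _ _ f) => [y /cases|y z /cases + /cases].
  move=> [->|[[n <-]|[Ay ny]]]; first by rewrite fx; exact: eA.
  - by rewrite fe; exact: eA.
  - by rewrite fE.
move=> [->|[[n <-]|[Ay ny]]] [->|[[m <-]|[Az nz]]] //;
  rewrite ?fx ?fe ?(fE y)// ?(fE z)// => E.
- by have := einj _ _ I I E.
- by case: nz; exists 0%N.
- by have := einj _ _ I I E.
- by have [->] := einj _ _ I I E.
- by case: nz; exists n.+1.
- by case: ny; exists 0%N.
- by case: ny; exists m.+1.
Qed.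

(** [G] receives a total function, equal to the default [e] off the predecessors of [x], so that
    users avoid dependent types. *)
Lemma wf_recursion T (R : T -> T -> Prop) (E : Type) (e : E)
    (G : T -> (T -> E) -> E) : well_founded R ->
  exists s : T -> E, forall x,
    s x = G x (fun y => if `[<R y x>] then s y else e).
Proof.
move=> wfR.
pose F x (r : forall y, R y x -> E) :=
  G x (fun y => if pselect (R y x) is left p then r y p else e).
exists (Fix wfR (fun=> E) F) => x.
rewrite Fix_eq.
  rewrite /F; congr G; apply/funext => y.
  by case: pselect => [p|p]; case: asboolP.
move=> {}x r1 r2 r12; rewrite /F; congr G; apply/funext => y.
by case: pselect.
Qed.

(** Recursion sends each [x] to a point of [B] not taken by its predecessors, which are too few to
    exhaust [B]. *)
Lemma wf_embedding T U (u : U) (R : T -> T -> Prop) (D : set T) (B : set U) :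
  well_founded R ->
  (forall x y, D x -> D y -> x <> y -> R x y \/ R y x) ->
  (forall x, D x -> [set y | D y /\ R y x] #< B) -> D #<= B.
Proof.
move=> wfR tri ltB.
have [c cP] := choice_function u.
pose G x (s : T -> U) := c (B `\` s @` [set y | D y /\ R y x]).
have [s sE] := wf_recursion u G wfR.
have sP x : D x -> B (s x) /\ forall y, D y -> R y x -> s y <> s x.
  move=> Dx; pose s' y := if `[<R y x>] then s y else u.
  have : (B `\` s' @` [set y | D y /\ R y x]) !=set0.
    apply: contrapT => ne; have /card_ltNge := ltB _ Dx; apply.
    apply: card_le_trans (card_image_le s' _); apply: subset_card_le => b Bb.
    by apply: contrapT => nb; apply: ne; exists b.
  move=> /cP; rewrite [X in _ -> B X /\ _]sE -/s' /G => -[Bs ns]; split => //.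
  move=> y Dy Ryx; rewrite [RHS]sE -/s' => syx; apply: ns; exists y => //.
  by rewrite /s'; case: asboolP => // _; rewrite syx.
apply: (@card_le_injP _ _ _ _ s) => [x /sP[]//|x y Dx Dy sxy].
apply: contrapT => /(tri _ _ Dx Dy)[].
  by move=> /((sP _ Dy).2 _ Dx); apply.
by move=> /((sP _ Dx).2 _ Dy); apply.
Qed.

(** * Infinite cardinals as elements of a well-order *)

Section WellOrder.
Context (d : Order.disp_t) (L : orderType d).
Hypothesis woL : wochoice.well_order (<=%O : rel L).

Lemma wo_least (P : set L) : P !=set0 ->
  exists2 m, P m & forall x, P x -> m <= x.
Proof.
move=> [x Px]; have [|m [[Pm mle] _]] := woL (A := [pred y | `[<P y>]]).
  by exists x; apply/asboolP.
exists m; first exact/asboolP.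
by move=> y Py; apply/mle/asboolP.
Qed.

Lemma wo_wf : well_founded (fun x y : L => x < y).
Proof.
move=> x; apply: contrapT => nAcc.
have [m nm mle] := wo_least (P := [set y | ~ Acc (fun x y : L => x < y) y])
  (ex_intro _ x nAcc).
apply: nm; constructor => y ym; apply: contrapT => /mle.
by rewrite leNgt ym.
Qed.

Lemma below_sub (x y : L) : x <= y -> below x `<=` below y.
Proof. by move=> xy z /= zx; exact: lt_le_trans xy. Qed.

Lemma below_le_card (x y : L) : x <= y -> below x #<= below y.
Proof. by move=> xy; apply/subset_card_le/below_sub. Qed.

Lemma upto_below (x : L) : upto x = below x `|` [set x].
Proof.
apply/seteqP; split=> y; rewrite /upto /below /=.
  by rewrite le_eqVlt => /orP[/eqP|]; [right|left].
by move=> [/ltW|->].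
Qed.

Lemma upto_card (x : L) : infinite_set (below x) -> upto x #<= below x.
Proof. by move=> ix; rewrite upto_below; exact: infinite_setU1_le. Qed.

Lemma finite_upto (x : L) : finite_set (below x) -> finite_set (upto x).
Proof. by move=> fx; rewrite upto_below finite_setU. Qed.

Lemma cardinal_limit (x y : L) : is_cardinal x -> infinite_set (below x) ->
  y < x -> exists2 z, y < z & z < x.
Proof.
move=> cx ix yx; apply: contrapT => nz.
have xy : below x `<=` upto y.
  by move=> z zx; rewrite /upto /= leNgt; apply/negP => yz; apply: nz; exists z.
have [fy|iy] := pselect (finite_set (below y)).
  exact/ix/(sub_finite_set xy)/finite_upto.
have /card_ltNge := cx _ yx; apply.
exact: card_le_trans (subset_card_le xy) (upto_card iy).
Qed.

(** Goedel's well-order of pairs: by maximum, then lexicographically. *)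
Let godel (p q : L * L) : Prop :=
  (Order.max p.1 p.2 < Order.max q.1 q.2) \/
  (Order.max p.1 p.2 = Order.max q.1 q.2 /\
   (p.1 < q.1 \/ (p.1 = q.1 /\ p.2 < q.2))).

Let godel_wf : well_founded godel.
Proof.
move=> [a b].
have [m] : exists m, m = Order.max a b by exists (Order.max a b).
elim/(well_founded_ind wo_wf): m a b => m IHm a.
elim/(well_founded_ind wo_wf): a => a IHa b.
elim/(well_founded_ind wo_wf): b => b IHb mE.
constructor => -[c e]; rewrite /godel /= -mE => -[ltm|[eqm [ca|[ca eb]]]].
- exact: IHm ltm _ _ erefl.
- exact: IHa ca _ (esym eqm).
- by rewrite ca in eqm *; exact: IHb eb (esym eqm).
Qed.

Let godel_tri p q : p <> q -> godel p q \/ godel q p.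
Proof.
move: p q => [a b] [c e] npq; rewrite /godel /=.
have [E|E|E] := ltgtP (Order.max a b) (Order.max c e).
- by left; left.
- by right; left.
have [ac|ac|ac] := ltgtP a c.
- by left; right; split => //; left.
- by right; right; split => //; left.
have [be|be|be] := ltgtP b e.
- by left; right; split => //; right.
- by right; right; split => //; right.
- by case: npq; rewrite ac be.
Qed.

(** Hessenberg's theorem. If [x] is not a cardinal, pass to a smaller equipotent [y]. If it is, each
    proper initial segment of [godel] lies in the square of some [below z] with [z < x], which is
    smaller than [x] by induction, and [wf_embedding] applies. *)
Lemma card_square (x : L) : infinite_set (below x) ->
  below x `*` below x #<= below x.
Proof.
elim/(well_founded_ind wo_wf): x => x IH ix.
have [cx|ncx] := pselect (is_cardinal x); last first.
  have [y yx xy] : exists2 y, y < x & below x #<= below y.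
    apply: contra_notP ncx => ne y yx; apply/card_ltNge => xy.
    by apply: ne; exists y.
  have iy : infinite_set (below y) by apply: contra_not ix; exact: card_le_finite.
  apply: card_le_trans (below_le_card (ltW yx)).
  apply: card_le_trans (IH _ yx iy).
  have [f [fB finj]] := card_le_inj x xy.
  apply: (@card_le_injP _ _ _ _ (fun p => (f p.1, f p.2))).
    by move=> [a b] [/= /fB ? /fB ?].
  move=> [a b] [c e] [/= xa xb] [/= xc xe] [] /(finj _ _ xa xc) -> .
  by move=> /(finj _ _ xb xe) ->.
apply: (wf_embedding x godel_wf) => [p q _ _ /godel_tri//|[a b] [/= xa xb]].
pose m := Order.max a b.
have mx : m < x by rewrite /m gt_max xa.
have [z mz zx] := cardinal_limit cx ix mx.
have sub : [set p | (below x `*` below x) p /\ godel p (a, b)]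
    `<=` below z `*` below z.
  move=> [c e] [_]; rewrite /godel /= => h.
  have cez : Order.max c e < z.
    apply: le_lt_trans mz; case: h => [/ltW//|[-> _]]; exact: lexx.
  by move: cez; rewrite gt_max => /andP[].
apply: (card_le_lt_trans (subset_card_le sub)).
have [fz|iz] := pselect (finite_set (below z)).
  apply/card_ltNge => le; apply: ix; apply: card_le_finite le _.
  exact: finite_setX.
exact: card_le_lt_trans (IH _ zx iz) (cx _ zx).
Qed.

End WellOrder.

(** * The projection to kappa *)

Lemma complete_bigcup (d : Order.disp_t) (L : orderType d) (k : L) (T I : Type)
    (J : set (set T)) (X : set I) (F : I -> set T) :
  complete k J -> X #< below k -> (forall i, X i -> J (F i)) ->
  J (\bigcup_(i in X) F i).
Proof.
move=> cJ Xk JF; rewrite -(bigcup_image X F id); apply: cJ.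
  by move=> _ [i Xi <-]; exact: JF.
exact: card_le_lt_trans (card_image_le F X) Xk.
Qed.

Section Regular.
Context (d : Order.disp_t) (L : orderType d) (kappa : L).
Hypothesis woL : wochoice.well_order (<=%O : rel L).
Hypothesis regk : regular kappa.

Let cardk : is_cardinal kappa. Proof. by case: regk. Qed.
Let infk : infinite_set (below kappa). Proof. by case: regk. Qed.

Lemma regular_limit y : y < kappa -> exists2 z, y < z & z < kappa.
Proof. exact: cardinal_limit. Qed.

Lemma regular_bounded T (X : set T) (h : T -> L) : X #< below kappa ->
  (forall x, X x -> h x < kappa) ->
  exists2 b, b < kappa & forall x, X x -> h x <= b.
Proof.
move=> Xk hk; apply: contrapT => nb.
have [_ _ /(_ (h @` X)) unbounded_eq] := regk.
have [_ /negP] := card_le_lt_trans (card_image_le h X) Xk; apply.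
apply: unbounded_eq => [_ [x Xx <-]|y yk]; first exact: hk.
apply: contrapT => nz; apply: nb; exists y => // x Xx.
rewrite leNgt; apply/negP => yx; apply: nz; exists (h x); last exact: ltW.
by exists x.
Qed.

Lemma finite_lt_regular T (X : set T) : finite_set X -> X #< below kappa.
Proof. by move=> fX; apply/card_ltNge => /card_le_finite/(_ fX). Qed.

(** Suppose kappa injects into the union. The points assigned to a given [F i] are bounded, these
    bounds have a common bound [c] below kappa, and a point above [c] can be assigned to no
    [F i]. *)
Lemma bigcup_lt_regular T I (X : set I) (F : I -> set T) : X #< below kappa ->
  (forall i, X i -> F i #< below kappa) -> \bigcup_(i in X) F i #< below kappa.
Proof.
move=> Xk Fk; apply/card_ltNge => kF.
have [[u [i0 Xi0 _]]|ne] := pselect (\bigcup_(i in X) F i !=set0); last first.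
  apply: infk; apply: card_le_finite kF _.
  by rewrite (_ : \bigcup_(_ in _) _ = set0) // -subset0 => x Fx; apply: ne; exists x.
have [f [fF finj]] := card_le_inj u kF.
have /choice[i iP] : forall x, exists i, x < kappa -> X i /\ F i (f x).
  by move=> x; have [/fF[i ? ?]|_] := boolP (x < kappa); [exists i|exists i0].
have /choice[b bP] : forall j, exists b, X j ->
    b < kappa /\ forall x, x < kappa -> i x = j -> x <= b.
  move=> j; have [Xj|] := pselect (X j); last by exists kappa.
  have [|//|b bk xb] :=
    @regular_bounded _ [set x | x < kappa /\ i x = j] id.
  - apply: card_le_lt_trans (Fk _ Xj).
    apply: (@card_le_injP _ _ _ _ f) => [x [xk <-]|x y [xk _] [yk _]].
      by have [] := iP _ xk.
    exact: finj.
  - by move=> x [].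
  - by exists b => _; split => // x xk ij; apply: xb.
have [|c ck bc] := regular_bounded Xk (h := b); first by move=> j /bP[].
have [z cz zk] := regular_limit ck.
have [Xi _] := iP _ zk.
have := le_trans ((bP _ Xi).2 _ zk erefl) (bc _ Xi).
by rewrite leNgt cz.
Qed.

(** * The map [pi] and the ideal it induces on kappa *)

Section UnionCap.
Local Notation pi := (union_cap kappa).

(** By regularity the elements of [a] below kappa are bounded below kappa, so the supremum exists
    and the default of [xget] is not taken. *)
Lemma union_capP a : Pkl kappa a ->
  pi a < kappa /\ forall x, a x -> x < kappa -> x <= pi a.
Proof.
move=> ak.
have [|x [_ //]|b bk ub] := @regular_bounded _ (a `&` below kappa) id.
  by apply: card_le_lt_trans ak; exact: subset_card_le.
have [m um ml] := wo_least woL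
  (ex_intro (ubound (a `&` below kappa)) b ub).
have [um' lm'] : supremums (a `&` below kappa) (pi a).
  by apply: xgetPex; exists m; split.
split; first exact: le_lt_trans (lm' _ ub) bk.
by move=> x ax xk; apply: um'.
Qed.

Context (H : set (set (set L))).
Hypothesis idH : ideal_on_Pkl kappa H.

Lemma ideal_sub A B : B `<=` A -> H A -> H B.
Proof. by have [[_ _ _ subH _] _ _] := idH; exact: subH. Qed.

Lemma ideal_setU A B : H A -> H B -> H (A `|` B).
Proof. by have [[_ _ _ _ [UH _]] _ _] := idH; exact: UH. Qed.

Lemma fine_not_sub a : Pkl kappa a -> H [set b | Pkl kappa b /\ ~ a `<=` b].
Proof.
move=> ak; have [_ _ fineH] := idH; apply: fineH; split; first by move=> b [].
by exists a => //; rewrite -subset0 => b [[_ nab] [_ ab]].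
Qed.

(** By fineness almost every [b] contains a given [z] between [y] and kappa, and then
    [z <= pi b]. *)
Lemma fine_union_cap_le y : y < kappa -> H [set b | Pkl kappa b /\ pi b <= y].
Proof.
move=> yk; have [z yz zk] := regular_limit yk.
have zP : Pkl kappa [set z] by exact: finite_lt_regular.
apply: ideal_sub (fine_not_sub zP) => b [bP by_]; split => // zb.
have [_ /(_ z (zb _ erefl) zk)] := union_capP bP.
by rewrite leNgt (le_lt_trans by_ yz).
Qed.

Context (F : L * L -> bool) (B : set (set L)).
Hypothesis posB : positive (Pkl kappa) H B.

Let BP b : B b -> Pkl kappa b. Proof. by case: posB => + _; exact. Qed.

(** Within [B] this is the union of the sets N_x over [x < y]. *)
Definition joined (y : L) : set (set L) := [set b |
  exists x, [/\ x < y, (pi @` B) x, x < pi b & F (x, pi b)]].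

Lemma joined_mono y z : y <= z -> joined y `<=` joined z.
Proof.
by move=> yz b [x [xy ? ? ?]]; exists x; split => //; exact: lt_le_trans yz.
Qed.

(* the ideal generated by the projection of H | B and by the sets of ordinals
   joined to some element of pi @` B below y, for y < kappa *)
Definition proj_ideal : set (set L) := [set Y | Y `<=` below kappa /\
  exists2 y, y < kappa & H [set b | [/\ B b, Y (pi b) & ~ joined y b]]].

Hypothesis not_joined : forall y, y < kappa -> ~ H (B `\` joined y).

Let kappa_has : exists y, y < kappa.
Proof. by have [y] := infinite_setN0 infk; exists y. Qed.

(** For completeness, the witnesses [y] of fewer than kappa members have a common bound below kappa.
    Properness comes from [not_joined]. *)
Lemma proj_ideal_on : ideal_on kappa proj_ideal.
Proof.
have cH : complete kappa H by case: idH.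
split; last first.
  move=> X XJ Xk; split; first by move=> y [Y /XJ[sY _]]; exact: sY.
  have /choice[g gP] : forall Y, exists y, X Y -> y < kappa /\
      H [set b | [/\ B b, Y (pi b) & ~ joined y b]].
    move=> Y; have [/XJ[_ [y ? ?]]|] := pselect (X Y); first by exists y.
    by exists kappa.
  have [|c ck gc] := regular_bounded Xk (h := g); first by move=> Y /gP[].
  exists c => //.
  apply: ideal_sub (complete_bigcup cH Xk (fun Y XY => (gP Y XY).2)) => b.
  move=> [Bb [Y XY Yb] nj]; exists Y => //; split => //.
  by apply: contra_not nj; apply/joined_mono/gc.
split => //.
- by move=> A [].
- move=> s sk; split; first by move=> _ ->.
  exists s => //; apply: ideal_sub (fine_union_cap_le sk) => b [Bb /= bs _].
  by split; [exact: BP|rewrite bs].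
- move=> A A' sA [Ak [y yk Hy]]; split; first exact: subset_trans sA Ak.
  by exists y => //; apply: ideal_sub Hy => b [? /sA ? ?].
split.
  move=> A A' [Ak [y yk Hy]] [A'k [z zk Hz]]; split; first by rewrite subUset.
  exists (Order.max y z); first by rewrite gt_max yk.
  apply: ideal_sub (ideal_setU Hy Hz) => b [Bb [Ab|A'b] nj]; [left|right].
    by split => //; apply: contra_not nj; apply: joined_mono; rewrite le_max lexx.
  by split => //; apply: contra_not nj; apply: joined_mono; rewrite le_max lexx orbT.
move=> [_ [y yk Hy]]; apply: (not_joined yk); apply: ideal_sub Hy => b [Bb nj].
by split => //; have [] := union_capP (BP Bb).
Qed.

(* A set D of H contains {b | pi b <= y} only for y bounded by some e D, so the
   generators of H can index those of the projection, with joined (e D) absorbing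
   the choice of y. *)
Lemma proj_generates (X : set (set (set L))) : generates X H ->
  exists2 Y, generates Y proj_ideal & Y #<= X.
Proof.
move=> [XH HE].
have /choice[e eP] : forall D, exists y, H D -> y < kappa /\
    ~ [set b | Pkl kappa b /\ pi b <= y] `<=` D.
  move=> D; have [HD|] := pselect (H D); last by exists kappa.
  apply: contrapT => /forallNP ne.
  have [[_ _ _ _ [_ nH]] _ _] := idH; apply: nH.
  apply: ideal_sub HD => b bP; have [bk _] := union_capP bP.
  apply: contrapT => nDb; apply: (ne (pi b)) => _; split => // /(_ b).
  by apply: contra_not nDb; apply.
pose G D := [set x | x < kappa /\
  forall b, B b -> pi b = x -> joined (e D) b \/ D b].
have GJ D : X D -> proj_ideal (G D).
  move=> /XH HD; split; first by move=> x [].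
  exists (e D); first by have [] := eP _ HD.
  by apply: ideal_sub HD => b [Bb [_ /(_ b Bb erefl)[]]].
exists (G @` X); last exact: card_image_le.
split; first by move=> _ [D XD <-]; exact: GJ.
apply/seteqP; split => [Y [Yk [y yk HY]]|Y [_ [D XD <-] sY]]; last first.
  have [[_ _ _ subJ _] _] := proj_ideal_on.
  exact: subJ sY (GJ _ XD).
have := ideal_setU HY (fine_union_cap_le yk); rewrite HE => -[D XD sD].
exists (G D); first by exists D.
move=> x Yx; split; first exact: Yk.
move=> b Bb bx; have [?|nj] := pselect (joined (e D) b); [by left|right].
apply: (sD); left; split => //; first by rewrite bx.
apply: contra_not nj; apply: joined_mono.
have [_ ne] := eP _ (XH _ XD); rewrite leNgt; apply/negP => /ltW ey.
by apply: ne => c [cP cy]; apply: sD; right; split => //; exact: le_trans ey.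
Qed.

(** By [proj_generates] the cofinality of [proj_ideal], attained by [Z], is at most cof(H), hence
    too small for an ideal that is not weakly selective. *)
Lemma proj_weakly_selective (U V : Type) (cofH : set U) (non : set V) :
  is_cof H cofH -> is_non_weakly_selective kappa non -> cofH #< non ->
  weakly_selective kappa proj_ideal.
Proof.
move=> [[X genX Xcof] _] [_ nonP] /card_ltNge ltc; apply: contrapT => nws.
apply: ltc; have [Y genY YX] := proj_generates genX.
have [Z genZ minZ] := exists_card_min (ex_intro (fun Z => generates Z proj_ideal) _ genY).
apply: card_le_trans (nonP _ Z proj_ideal_on nws _) _.
  by split => //; exists Z.
apply: card_le_trans (minZ _ genY) _; apply: card_le_trans YX _.
by move: Xcof; rewrite card_eq_le => /andP[].
Qed.

(** The weak P-point property thins [S] until every [N x] is bounded in it; the weak Q-point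
    property thins it further so that each element exceeds the bounds set by the earlier ones, and
    no pair of colour 1 is left. *)
Lemma homogeneous_of_selective : weakly_selective kappa proj_ideal ->
  exists2 C, C `<=` B & positive (Pkl kappa) H C /\
    forall p, pairs_kk kappa C p -> F p = false.
Proof.
move=> [wP wQ]; have [[_ _ sing subJ [UJ nJk]] _] := proj_ideal_on.
pose S := pi @` B.
have Sk : S `<=` below kappa by move=> _ [b /BP/union_capP[] ? _ <-].
have posS : positive (below kappa) proj_ideal S.
  split => // -[_ [y yk Hy]]; apply: (not_joined yk).
  by apply: ideal_sub Hy => b [Bb nj]; split => //; exists b.
pose N x := [set z | [/\ S x, S z, x < z & F (x, z)]].
have NJ x : x < kappa -> proj_ideal (N x).
  move=> xk; split; first by move=> z [_ /Sk].
  (* Whatever projects into [N x] is joined at any [y] above [x], so the set required to be in [H]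
     is empty. *)
  have [y xy yk] := regular_limit xk; exists y => //.
  rewrite (_ : [set _ | _] = set0); last first.
    rewrite -subset0 => b [Bb [Sx Sb xb Fxb] nj].
    by apply: nj; exists x.
  have [y0 y0k] := kappa_has.
  exact: ideal_sub (fine_union_cap_le y0k).
(* [f z] is the least [x] joined to [z], or [z] itself if there is none; its fibre over [x] lies in
   [N x] plus the point [x]. *)
have /choice[f fP] : forall z, exists x, S z ->
    (N x z \/ x = z) /\ forall w, N w z -> x <= w.
  move=> z; have [[w0 Nw0]|nw] := pselect ([set w | N w z] !=set0).
    have [m ? ?] := wo_least woL (ex_intro [set w | N w z] _ Nw0).
    by exists m => _; split; [left|].
  by exists z => Sz; split; [right|move=> w Nw; case: nw; exists w].
have fk z : S z -> f z < kappa.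
  by move=> Sz; have [[[Sf _ _ _]|->] _] := fP _ Sz; exact: Sk.
have [||B1 [[B1k nB1] B1S smallB1]] := wP S f posS.
- by move=> z /fk.
- move=> x xk; apply: subJ (UJ _ _ (NJ _ xk) (sing _ xk)) => z [Sz /= fzx].
  by have [[Nz|fz] _] := fP _ Sz; [left; rewrite -fzx|right; rewrite -fzx fz].
(* On members of [N x] the value of [f] is at most [x], so within [B1] they lie in fewer than kappa
   small fibres and have a bound [g x]. *)
have /choice[g gP] : forall x, exists y, x < kappa ->
    y < kappa /\ forall z, N x z -> B1 z -> z <= y.
  move=> x; have [xk|] := boolP (x < kappa); last by exists kappa.
  have [|//|b bk zb] := @regular_bounded _
      (\bigcup_(w in upto x) (B1 `&` f @^-1` [set w])) id.
  - apply: bigcup_lt_regular => [|w wx]; last exact/smallB1/(le_lt_trans wx xk).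
    have [y xy yk] := regular_limit xk.
    apply: card_le_lt_trans (cardk yk); apply: subset_card_le => z zx.
    exact: le_lt_trans xy.
  - by move=> z [w _ [/B1k]].
  - exists b => _; split => // z Nz B1z; apply: zb; exists (f z) => //.
    by have [_] := fP _ (B1S _ B1z); exact.
have gk : set_fun (below kappa) (below kappa) g by move=> x /gP[].
have [B2 [B2k nB2] B2g] := wQ _ (conj B1k nB1) g gk.
pose C := [set b | B b /\ (B2 `&` B1) (pi b)].
exists C; first by move=> b [].
split; last first.
  move=> _ [a [b [[Ba [B2a B1a]] [Bb [B2b B1b]] ab ->]]]; apply/negP => Fab.
  have /= := B2g (pi a, pi b) (And3 B2a B2b ab); rewrite ltNge => /negP; apply.
  by apply: (gP _ (B1k _ B1a)).2 => //; split => //; exact: B1S.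
split; first by move=> b [/BP].
move=> HC; apply: nB2; split => //; split; first by move=> x [/B2k].
have [y yk] := kappa_has; exists y => //.
by apply: ideal_sub HC => b [Bb ? _].
Qed.

End UnionCap.
End Regular.

(** * Trees with few nodes *)

Section Words.
Context (d : Order.disp_t) (L : orderType d).
Hypothesis woL : wochoice.well_order (<=%O : rel L).

(* the cofinality of y exceeds the cardinality of x *)
Definition bounding (x y : L) := forall (D : set L) (h : L -> L),
  D `<=` below x -> (forall i, D i -> h i < y) ->
  exists2 b, b < y & forall i, D i -> h i <= b.

(** [r] is the least ordinal whose initial segment is not tiny. An unbounded map into [r] from part
    of [below x] would make [below r] a tiny union, and a last element would make it tiny too. *)
Lemma least_not_tiny_bounding (tiny : set L -> Prop) (x y : L) :
  (forall A B, A `<=` B -> tiny B -> tiny A) ->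
  (forall z, tiny (below z) -> tiny (upto z)) ->
  (forall (D : set L) h, D `<=` below x -> (forall i, D i -> tiny (upto (h i))) ->
    tiny (\bigcup_(i in D) upto (h i))) ->
  ~ tiny (below y) ->
  exists2 r, r <= y & bounding x r /\ forall z, z < r -> exists2 w, z < w & w < r.
Proof.
move=> tinyS tinyU tinyC ny.
have [r nr rle] := wo_least woL (ex_intro [set z | ~ tiny (below z)] y ny).
have tinyr z : z < r -> tiny (upto z).
  move=> zr; apply: tinyU; apply: contrapT => /rle.
  by rewrite leNgt zr.
exists r; first exact: rle.
split=> [D h Dx hr|z zr].
  apply: contrapT => nb; apply: nr.
  apply: tinyS (tinyC D h Dx _) => [z zr|i Di]; last exact/tinyr/hr.
  apply: contrapT => nz; apply: nb; exists z => // i Di.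
  by rewrite leNgt; apply/negP => /ltW zh; apply: nz; exists i.
apply: contrapT => nw; apply: nr; apply: tinyS (tinyr _ zr) => w wr.
by rewrite /upto /= leNgt; apply/negP => zw; apply: nw; exists w.
Qed.

(** As [y] may be singular, [r] is omega when [below x] is finite, and otherwise the cardinal
    successor of its cardinality. *)
Lemma cardinal_bounding (x y : L) : is_cardinal y -> infinite_set (below y) ->
  x < y ->
  exists2 r, r <= y & bounding x r /\ forall z, z < r -> exists2 w, z < w & w < r.
Proof.
move=> cy iy xy; have [fx|ix] := pselect (finite_set (below x)).
  apply: (least_not_tiny_bounding (tiny := @finite_set L)) => //.
  - by move=> A B; exact: sub_finite_set.
  - exact: finite_upto.
  - move=> D h Dx hD; apply: bigcup_finite => //; exact: sub_finite_set fx.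
apply: (least_not_tiny_bounding (tiny := fun A => A #<= below x)).
- by move=> A B /subset_card_le; exact: card_le_trans.
- move=> z zx; have [fz|iz] := pselect (finite_set (below z)).
    have [//|/card_le_finite/(_ (finite_upto fz))] := card_le_total (upto z) (below x).
    by move/ix.
  exact: card_le_trans (upto_card iz) zx.
- move=> D h Dx hD; apply: card_le_trans (card_square woL ix).
  have /choice[f fP] : forall i, exists f : L -> L, D i ->
      (forall z, upto (h i) z -> below x (f z)) /\
      (forall z w, upto (h i) z -> upto (h i) w -> f z = f w -> z = w).
    move=> i; have [/hD/(card_le_inj x)[f ?]|] := pselect (D i); first by exists f.
    by exists id.
  have /choice[e eP] : forall z, exists i,
      (\bigcup_(i in D) upto (h i)) z -> D i /\ upto (h i) z.
    move=> z; have [[i ? ?]|] := pselect ((\bigcup_(i in D) upto (h i)) z).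
      by exists i.
    by exists x.
  apply: (@card_le_injP _ _ _ _ (fun z => (e z, f (e z) z))).
    by move=> z /eP[De ez]; split => /=; [exact: Dx|apply: (fP _ De).1].
  move=> z w /eP[De ez] /eP[Dw ew] [zw]; rewrite zw in De ez *.
  exact: (fP _ Dw).2.
- by apply/card_ltNge; exact: cy.
Qed.

(** Induction on the position: the stages where the earlier letters settle are bounded below [y],
    and past that bound [step] settles the next letter. *)
Lemma eventually_constant E (G : L -> L -> E) (x y : L) : bounding x y ->
  (forall e a, e < x -> a < y ->
    (forall z, a <= z -> z < y -> forall i, i < e -> G z i = G a i) ->
    exists2 b, b < y & forall z, b <= z -> z < y -> G z e = G b e) ->
  exists2 a, a < y & forall z, a <= z -> z < y -> forall i, i < x -> G z i = G a i.
Proof.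
move=> bxy step.
have agree e : e <= x -> (forall i, i < e -> exists2 b, b < y &
      forall z, b <= z -> z < y -> G z i = G b i) ->
    exists2 a, a < y & forall z, a <= z -> z < y -> forall i, i < e -> G z i = G a i.
  move=> ex cst.
  have /choice[h hP] : forall i, exists b, i < e -> b < y /\
      forall z, b <= z -> z < y -> G z i = G b i.
    move=> i; have [/cst[b ? ?]|_] := boolP (i < e); [by exists b|by exists x].
  have [||b by_ hb] := bxy (below e) h.
  - exact: below_sub.
  - by move=> i /hP[].
  - exists b => // z bz zy i ie; have [hy hG] := hP _ ie.
    by rewrite !hG ?hb// (le_trans (hb _ ie) bz).
apply: (agree x) => // i.
elim/(well_founded_ind (wo_wf woL)): i => e IH ex.
have [i ie|a ay aP] := agree _ (ltW ex); last exact: step aP.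
by apply: IH => //; exact: lt_trans ex.
Qed.

Context (kappa theta : L).
Hypothesis regk : regular kappa.

Lemma regular_bounding x : x < kappa -> bounding x kappa.
Proof.
move=> xk D h Dx hk; apply: regular_bounded hk => //.
have [ck _ _] := regk.
exact: card_le_lt_trans (subset_card_le Dx) (ck _ xk).
Qed.

(* Otherwise colour pairs of words according to whether the lexicographic order
   agrees with an enumeration in type kappa: monotone sequences of words
   stabilize letter by letter. *)
Lemma card_words_lt E (p : E -> L) (T : set (L -> E)) (x : L) :
  infinite_cardinal theta -> theta < kappa -> arrow kappa (below theta) ->
  x < theta ->
  (forall s e, T s -> e < x -> exists2 c, c < kappa &
    forall t, T t -> (forall i, i < e -> t i = s i) -> p (t e) < c) ->
  (forall s t e, T s -> T t -> e < x -> (forall i, i < e -> t i = s i) ->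
    p (t e) = p (s e) -> t e = s e) ->
  (forall s t, T s -> T t -> (forall i, i < x -> t i = s i) -> t = s) ->
  T #< below kappa.
Proof.
move=> [ct it] tk arr xt bnd inj ext; apply/card_ltNge => kT.
have [ck ik _] := regk.
have [[u Tu]|ne] := pselect (T !=set0); last first.
  apply: ik; apply: card_le_finite kT _.
  by rewrite (_ : T = set0) // -subset0 => s Ts; apply: ne; exists s.
have [g [gT ginj]] := card_le_inj u kT.
(* [lex s t] says that [t] comes before [s], so colour 1 marks the descents of [g]. *)
pose lex s t := exists2 e, e < x &
  (forall i, i < e -> t i = s i) /\ p (t e) < p (s e).
have [Z Zk] := arr (fun q => `[< lex (g q.1) (g q.2) >]).
(* An injective sequence of limit length cannot stabilize: by [ext] two late terms would
   coincide. *)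
have contra (r : L) (h : L -> L) : (forall z, z < r -> Z (h z)) ->
    {in below r &, injective h} ->
    (forall z, z < r -> exists2 w, z < w & w < r) ->
    ~ exists2 a, a < r &
      forall z, a <= z -> z < r -> forall i, i < x -> g (h z) i = g (h a) i.
  move=> hZ hinj lim [a ar aP]; have [z az zr] := lim _ ar.
  have hza : h z = h a.
    apply: ginj; try exact/Zk/hZ.
    by apply: ext; [exact/gT/Zk/hZ|exact/gT/Zk/hZ|exact: aP (ltW az) zr].
  have := hinj _ _ _ _ hza; rewrite !inE => /(_ zr ar) za.
  by rewrite za ltxx in az.
move=> [[[h [hZ hinj _] hlt] col]|[[h [hZ hinj _] hlt] col]].
(* Colour 0: once the letters before [e] are fixed, the codes of letter [e] do not decrease and stay
   below some [c < kappa]. *)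
- refine (contra kappa h hZ hinj _ _); first exact: regular_limit.
  have xk := lt_trans xt tk.
  apply: (eventually_constant (G := fun z => g (h z))) (regular_bounding xk) _.
  move=> e a ex ak agr.
  have Th z : z < kappa -> T (g (h z)) by move=> zk; exact/gT/Zk/hZ.
  have mono z w : a <= z -> z <= w -> w < kappa -> p (g (h z) e) <= p (g (h w) e).
    move=> az; rewrite le_eqVlt => /orP[/eqP->//|zw wk].
    have zk := lt_trans zw wk.
    have := col (h z, h w) (And3 (hZ _ zk) (hZ _ wk) ((hlt _ _ zk wk).1 zw)).
    move=> /asboolPn nlex; rewrite leNgt; apply/negP => ltp; apply: nlex.
    exists e => //; split => // i ie.
    by rewrite (agr z) ?(agr w) // (le_trans az (ltW zw)).
  have [c ck' cP] := bnd _ _ (Th _ ak) ex.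
  (* [f v] is a stage with code [v], if there is one; a stage past all [f v] with [v < c] already
     has the final code. *)
  have [f fP] : exists f, forall v, f v < kappa /\ a <= f v /\
      ((exists z, [/\ a <= z, z < kappa & p (g (h z) e) = v]) ->
       p (g (h (f v)) e) = v).
    suff /choice[f ?] : forall v, exists z, z < kappa /\ a <= z /\
      ((exists z, [/\ a <= z, z < kappa & p (g (h z) e) = v]) ->
       p (g (h z) e) = v) by exists f.
    move=> v; have [[z [? ? ?]]|nz] :=
      pselect (exists z, [/\ a <= z, z < kappa & p (g (h z) e) = v]).
      by exists z.
    by exists a.
  have [||b bk fb] := regular_bounding ck' (D := below c) (h := f) => //.
    by move=> v _; have [] := fP v.
  have [w wa wk] : exists2 w, Order.max a b <= w & w < kappa.
    by exists (Order.max a b); rewrite // gt_max ak.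
  move: wa; rewrite ge_max => /andP[aw bw].
  exists w => // z wz zk; have az := le_trans aw wz.
  have agrz i : i < e -> g (h z) i = g (h w) i by move=> ie; rewrite (agr z) ?(agr w).
  apply: inj => //; try exact: Th.
  apply/eqP; rewrite eq_le; apply/andP; split; last exact: mono.
  have [fk [af fv]] := fP (p (g (h z) e)).
  rewrite -fv; last by exists z.
  apply: mono => //; apply: le_trans bw; apply: fb.
  by apply: cP; [exact: Th|exact: agr].
(* Colour 1: only the first [r] terms are used, because theta itself may have small cofinality. *)
- have [r rt [bnr lim]] := cardinal_bounding ct it xt.
  have lt_theta z : z < r -> z < theta by move=> zr; exact: lt_le_trans rt.
  refine (contra r h _ _ lim _).
  + by move=> z zr; exact/hZ/lt_theta.
  + move=> z w; rewrite !inE => zr wr; apply: hinj; rewrite inE; exact: lt_theta.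
  apply: (eventually_constant (G := fun z => g (h z))) bnr _ => e a ex ar agr.
  (* From [a] on, letter [e] has its least code at stage [b]. A later descent from there cannot
     occur before [e], where letters are fixed, nor at [e], so it leaves letter [e] unchanged. *)
  have [_ [b [ab br <-]] bmin] := wo_least woL
    (P := [set v | exists z, [/\ a <= z, z < r & p (g (h z) e) = v]])
    (ex_intro _ _ (ex_intro _ a (And3 (lexx a) ar erefl))).
  exists b => // z; rewrite le_eqVlt => /orP[/eqP->//|bz zr].
  have [zt bt] := (lt_theta _ zr, lt_theta _ br).
  have := col (h b, h z) (And3 (hZ _ bt) (hZ _ zt) ((hlt _ _ bt zt).1 bz)).
  move=> /asboolP[/= e' e'x [agr' ltp]]; have az := le_trans ab (ltW bz).
  have [ee'|e'e|ee'] := ltgtP e e'; first exact: agr'.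
  + by move: ltp; rewrite (agr z) // (agr b) // ltxx.
  + have : p (g (h b) e) <= p (g (h z) e) by apply: bmin; exists z.
    by rewrite leNgt ee' ltp.
Qed.

End Words.

(** * The tree of chains *)

Section Tree.
Context (d : Order.disp_t) (L : orderType d) (kappa : L).
Hypothesis woL : wochoice.well_order (<=%O : rel L).
Hypothesis regk : regular kappa.
Local Notation pi := (union_cap kappa).
Context (H : set (set (set L))).
Hypothesis idH : ideal_on_Pkl kappa H.
Context (F : L * L -> bool).

Definition linked (a : set L) : set (set L) :=
  [set b | prec kappa a b /\ F (pi a, pi b)].

Definition small_cover (B X : set (set L)) := [/\ X `<=` B,
  exists2 y, y < kappa & forall a, X a -> pi a < y,
  forall a b, X a -> X b -> pi a = pi b -> a = b &
  H (B `\` \bigcup_(a in X) linked a)].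

(** Fix one representative [r x] over each [x < y] in the projection of [B]. By fineness and
    completeness almost every [b] includes them all, which strengthens [joined] to [linked]. *)
Lemma small_cover_of_joined B y : positive (Pkl kappa) H B -> y < kappa ->
  H (B `\` joined kappa F B y) -> exists X, small_cover B X.
Proof.
move=> [BP _] yk Hy; have [_ cH _] := idH.
have /choice[r rP] : forall x, exists a, (pi @` B) x -> B a /\ pi a = x.
  move=> x; have [[a Ba ax]|] := pselect ((pi @` B) x); first by exists a.
  by exists set0.
pose D := below y `&` pi @` B.
have Dk : D #< below kappa.
  have [ck _ _] := regk.
  by apply: card_le_lt_trans (ck _ yk); apply: subset_card_le => x [].
exists (r @` D); split.
- by move=> _ [x [_ /rP[Br _]] <-].
- by exists y => // _ [x [xy /rP[_ rx]] <-]; rewrite rx.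
- by move=> _ _ [x [_ /rP[_ rx]] <-] [z [_ /rP[_ rz]] <-]; rewrite rx rz => ->.
have Hr x : D x -> H [set b | Pkl kappa b /\ ~ r x `<=` b].
  by move=> [_ /rP[/BP ? _]]; exact: fine_not_sub.
apply: (ideal_sub idH _ (ideal_setU idH Hy (complete_bigcup cH Dk Hr))).
move=> b [Bb nb]; have [jb|] := pselect (joined kappa F B y b); last by left.
right; have [x [xy piBx xb Fxb]] := jb; exists x; first by split.
split; first exact: BP.
move=> rb; apply: nb; exists (r x); first by exists x; [split|].
by have [_ rx] := rP _ piBx; rewrite /linked /prec /= rx.
Qed.

Context (theta : L) (A : set (set L)).
Hypothesis theta_card : infinite_cardinal theta.
Hypothesis theta_lt : theta < kappa.
Hypothesis arrow_theta : arrow kappa (below theta).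
Hypothesis posA : positive (Pkl kappa) H A.
Hypothesis coverA : forall B, B `<=` A -> positive (Pkl kappa) H B ->
  exists X, small_cover B X.

Lemma exists_chain : exists (s : L -> set L) (b : set L),
  [/\ A b, forall e, e < theta -> A (s e) /\ linked (s e) b &
      forall i e, i < e -> e < theta -> linked (s i) (s e)].
Proof.
have [AP nHA] := posA; have [_ cH _] := idH.
(* [X] assigns a cover to every subset of [A]; the empty family serves for those in [H]. *)
have /choice[X XP] : forall B, exists X, B `<=` A -> small_cover B X.
  move=> B; have [HB|nHB] := pselect (H B).
    exists set0 => _; split => //; last by rewrite bigcup_set0 setD0.
    by exists theta.
  have [BA|] := pselect (B `<=` A); last by exists set0.
  have [|Y ?] := coverA BA; last by exists Y.
  by split=> //; exact: subset_trans AP.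
pose N (s : L -> set L) e := [set b | A b /\ forall i, i < e -> linked (s i) b].
have NA s e : N s e `<=` A by move=> b [].
have N_eq s t e : (forall i, i < e -> t i = s i) -> N t e = N s e.
  move=> ts; apply/seteqP; split=> b [Ab sb]; split => // i ie.
    by rewrite -ts //; exact: sb.
  by rewrite ts //; exact: sb.
(* [W e] is level [e] of the tree. The padding [set0] from [e] on makes words that agree below [e]
   equal. [D s e] below is what is lost at node [s]. *)
pose W e := [set s : L -> set L |
  (forall i, i < e -> X (N s i) (s i)) /\ forall i, ~ i < e -> s i = set0].
pose D s e := N s e `\` \bigcup_(a in X (N s e)) linked a.
have W_small e : e < theta -> W e #< below kappa.
  move=> et; apply: (card_words_lt woL regk (p := pi) theta_card theta_lt arrow_theta et).
  - move=> s i [sX _] ie; have [_ [c ck cP] _ _] := XP _ (@NA s i).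
    exists c => // t [tX _] ts; apply: cP; rewrite -(N_eq s t) //; exact: tX.
  - move=> s t i [sX _] [tX _] ie ts; have [_ _ inj _] := XP _ (@NA s i).
    by apply: inj; [rewrite -(N_eq s t) //; exact: tX|exact: sX].
  - move=> s t [_ s0] [_ t0] ts; apply/funext => i.
    by have [/ts//|/negP ie] := boolP (i < e); rewrite s0 ?t0.
have HD : H (\bigcup_(e in below theta) \bigcup_(s in W e) D s e).
  have [ck _ _] := regk.
  apply: (complete_bigcup cH (ck _ theta_lt)) => e et.
  apply: (complete_bigcup cH (W_small _ et)) => s _.
  by have [] := XP _ (@NA s e).
have [b Ab nDb] : exists2 b, A b &
    ~ (\bigcup_(e in below theta) \bigcup_(s in W e) D s e) b.
  apply: contrapT => nb; apply: nHA; apply: (ideal_sub idH _ HD) => b Ab.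
  by apply: contrapT => nDb; apply: nb; exists b.
have [c cP] := choice_function (set0 : set L).
(* The chain follows a [b] that is never lost: [s e] is picked in the current cover among the sets
   linked to [b]. *)
have [s sE] := wf_recursion set0
  (fun e s => c (X (N s e) `&` [set a | linked a b])) (wo_wf woL).
have sP e : e < theta -> X (N s e) (s e) /\ linked (s e) b.
  elim/(well_founded_ind (wo_wf woL)): e => e IH et.
  (* Cutting [s] at [e] gives a node of [W e]; since [b] is not lost there, a next letter exists. *)
  pose t i := if `[<i < e>] then s i else set0.
  have te i : i < e -> t i = s i by move=> ie; rewrite /t ie asboolT.
  have Nte i : i <= e -> N t i = N s i.
    by move=> ie; apply: N_eq => j ji; apply: te; exact: lt_le_trans ie.
  have Wt : W e t.
    split=> [i ie|i nie]; last by rewrite /t; case: asboolP.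
    by rewrite Nte ?(ltW ie)// te //; apply: (IH _ ie _).1; exact: lt_trans et.
  rewrite sE -/t -(Nte e) //.
  have [a Xa ab] : exists2 a, X (N t e) a & linked a b.
    apply: contrapT => na; apply: nDb; exists e => //; exists t => //; split.
      split=> // i ie; rewrite te //; apply: (IH _ ie _).2; exact: lt_trans et.
    by move=> [a Xa ab]; apply: na; exists a.
  by have [] := cP (X (N t e) `&` [set a | linked a b]) (ex_intro _ a (conj Xa ab)).
have sN e : e < theta -> N s e (s e).
  by move=> et; have [sub _ _ _] := XP _ (@NA s e); apply/sub/(sP e et).1.
exists s, b; split => // [e et|i e ie et].
  by split; [have [] := sN _ et|exact: (sP _ et).2].
by have [_] := sN _ et; exact.
Qed.

Lemma chain_order_type : exists2 B : set (set L), B `<=` A &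
  has_order_type (prec kappa) B (upto theta) /\
  forall p, pairs_kk kappa B p -> F p = true.
Proof.
have [s [b [Ab sb ss]]] := exists_chain.
(* [b] goes on top at position theta, which makes the type theta + 1. *)
pose g e := if e < theta then s e else b.
have gs e : e < theta -> g e = s e by rewrite /g => ->.
have gb : g theta = b by rewrite /g ltxx.
have gA e : upto theta e -> A (g e).
  by rewrite /upto /= le_eqVlt => /orP[/eqP->|et]; rewrite ?gb ?gs //; apply: (sb _ et).1.
have glink i e : i < e -> upto theta e -> linked (g i) (g e).
  move=> ie; rewrite /upto /= le_eqVlt => /orP[/eqP et|et]; last first.
    by rewrite !gs //; [exact: ss|exact: lt_trans et].
  by rewrite et in ie *; rewrite gb gs //; exact: (sb _ ie).2.
(* Homogeneity concerns pairs compared by [pi] alone, so the order of the indices is recovered from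
   [pi]. *)
have glt i e : upto theta i -> upto theta e -> pi (g i) < pi (g e) -> i < e.
  move=> it et ltp; rewrite ltNge; apply/negP; rewrite le_eqVlt => /orP[/eqP ei|ei].
    by rewrite ei ltxx in ltp.
  by have [[_ ltp'] _] := glink _ _ ei it; have := lt_trans ltp ltp'; rewrite ltxx.
exists (g @` upto theta); first by move=> _ [e /gA ? <-].
split.
  exists g; last first.
    by move=> i e it et; split=> [ie|[_ /glt]]; [case: (glink _ _ ie et)|exact].
  split=> [e et|i e|_ [e et <-]]; [by exists e| |by exists e].
  rewrite !inE => it et gie; apply/eqP; rewrite eq_le !leNgt.
  apply/andP; split; apply/negP => lt.
    by have [[_]] := glink _ _ lt it; rewrite gie ltxx.
  by have [[_]] := glink _ _ lt et; rewrite gie ltxx.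
move=> _ [_ [_ [[i it <-] [e et <-] lt ->]]].
by have [_] := glink _ _ (glt _ _ it et lt) et.
Qed.

End Tree.

(** * Combining the homogeneous set and the tree of chains *)

Theorem theorem11p4 (d : Order.disp_t) (L : orderType d) (kappa theta : L)
    (H : set (set (set L))) (U V : Type) (cofH : set U) (non : set V) :
  initial_ordinal L ->
  uncountable_regular kappa ->
  infinite_cardinal theta -> theta < kappa ->
  arrow kappa (below theta) ->
  ideal_on_Pkl kappa H ->
  is_cof H cofH ->
  is_non_weakly_selective kappa non ->
  cofH #< non ->
  arrow_kk kappa H (upto theta).
Proof.
move=> [woL _] [regk _] card_theta theta_lt arr idH cofP nonP lt_non F A posA.
have [[C [CA posC homC]]|nC] := pselect (exists C, [/\ C `<=` A,
    positive (Pkl kappa) H C & forall p, pairs_kk kappa C p -> F p = false]).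
  by exists C => //; left.
have cover B : B `<=` A -> positive (Pkl kappa) H B ->
    exists X, small_cover kappa H F B X.
  move=> BA posB.
  (* If no [y] works, [B] has a positive 0-homogeneous subset, against [nC]. *)
  have [[y yk Hy]|nj] := pselect (exists2 y, y < kappa & H (B `\` joined kappa F B y)).
    exact: (small_cover_of_joined regk idH posB yk Hy).
  have nj' y : y < kappa -> ~ H (B `\` joined kappa F B y).
    by move=> yk Hy; apply: nj; exists y.
  have [|C CB [posC homC]] := homogeneous_of_selective woL regk idH posB nj'.
    exact: proj_weakly_selective cofP nonP lt_non.
  by case: nC; exists C; split => //; exact: subset_trans BA.
have [B BA ?] := chain_order_type woL regk idH card_theta theta_lt arr posA cover.
by exists B => //; right.
Qed.
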